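(* Let $(\bar y,\bar x,\bar z,\bar\pi)$ be a feasible solution of the linear relaxation of the formulation $((1,p)\text{-F})$, and let $i\in O$. Consider the separation problem $$(S_i)\qquad \max\ \sum_{j\in D}\sum_{k\in H} e_{jk}\bar x_{ik}+\sum_{j\in D}\sum_{m\in H} f_{jm}\bar z_{ijm}\quad\text{s.t.}\quad e_{jk}+f_{jm}\le C_{ijkm}\ \ \forall j\in D,\ k,m\in H,$$ with $e_{jk},f_{jm}\in\mathbb{R}$ unrestricted. Then $(S_i)$ splits into $d=|D|$ independent subproblems, one for each $j\in D$, namely $$(S_{ij})\qquad \max\ \sum_{k\in H} e_k\bar x_{ik}+\sum_{m\in H} f_m\bar z_{ijm}\quad\text{s.t.}\quad e_k+f_m\le C_{ijkm}\ \ \forall k,m\in H,$$ with $e_k,f_m\in\mathbb{R}$ unrestricted (so the optimal value of $(S_i)$ is the sum over $j\in D$ of the optimal values of $(S_{ij})$, and optimal solutions of $(S_i)$ are exactly the collections of optimal solutions of the $(S_{ij})$). Moreover, each $(S_{ij})$ is the linear programming dual of the transportation problem with origins $k\in H$ with supplies $\bar x_{ik}$, destinations $m\in H$ with demands $\bar z_{ijm}$, and unit transportation cost $C_{ijkm}$ from $k$ to $m$.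
   Context: An instance of the $(1,p)$-Allocation Hub Location Problem consists of nonempty finite sets $O$ (origins), $D$ (destinations), $H$ (potential hubs) of cardinalities $o,d,h$ respectively, an integer $p$ with $2\le p\le h-1$ (maximum number of hubs), and costs $C_{ijkm}\ge 0$ for all $(i,j,k,m)\in O\times D\times H\times H$. For fixed $i\in O$, $j\in D$, $k\in H$, sort the $h$ values $C_{ijkm}$, $m\in H$, in increasing order (with repetitions); $M_{ijk}$ denotes the $(h-p+1)$-th entry of this sorted vector. The formulation $((1,p)\text{-F})$ is the mixed-integer linear program in variables $y_k$ ($k\in H$), $x_{ik}$ ($i\in O,k\in H$), $z_{ijm}$ ($i\in O,j\in D,m\in H$), $\pi_i$ ($i\in O$): minimize $\sum_{i\in O}\pi_i$ subject to - $\sum_{k\in H} y_k\le p$; - $x_{ik}\le y_k$ for all $i\in O,k\in H$; - $\sum_{k\in H}x_{ik}=1$ for all $i\in O$; - $\sum_{i\in O}\sum_{j\in D} z_{ijm}\le o\cdot d\cdot y_m$ for all $m\in H$; - $\sum_{m\in H} z_{ijm}=1$ for all $i\in O,j\in D$; - $\pi_i\ge \sum_{j\in D}\Big(\sum_{m\in H} C_{ijkm}z_{ijm}+M_{ijk}(x_{ik}-1)\Big)$ for all $i\in O,k\in H$; - $\pi_i\ge 0$ for all $i\in O$; - $y_k\in\{0,1\}$, $x_{ik}\in\{0,1\}$, $z_{ijm}\in\{0,1\}$ for all $i\in O$, $j\in D$, $k,m\in H$. Its linear relaxation is obtained by replacing each condition ''$\in\{0,1\}$'' by ''$\in[0,1]$''.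 The problem $(S_i)$ is the one of finding, for origin $i$, the most violated inequality at $(\bar y,\bar x,\bar z,\bar\pi)$ among the inequalities $\pi_i\ge\sum_{j\in D}\sum_{k\in H}e_{jk}x_{ik}+\sum_{j\in D}\sum_{m\in H}f_{jm}z_{ijm}$ with $e_{jk}+f_{jm}\le C_{ijkm}$ for all $j\in D$, $k,m\in H$. The (balanced) transportation problem with supplies $a_k\ge0$, demands $b_m\ge 0$ and unit costs $c_{km}$ ($k,m\in H$) is: minimize $\sum_{k,m\in H}c_{km}t_{km}$ subject to $\sum_{m\in H}t_{km}=a_k$ for all $k\in H$, $\sum_{k\in H}t_{km}=b_m$ for all $m\in H$, and $t_{km}\ge0$. *)

(* Defs.v *)
From HB Require Import structures.
From mathcomp Require Import all_boot all_order all_algebra.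
From mathcomp Require Import reals.
Set Implicit Arguments.
Unset Strict Implicit.
Unset Printing Implicit Defensive.
Import Order.TTheory GRing.Theory Num.Theory.
Local Open Scope ring_scope.

Inductive goal_kind := Minimize | Maximize.

Record problem (R : realType) (X : Type) := Problem {
  goal : goal_kind;
  feasible : X -> Prop;
  objective : X -> R
}.

Definition optimal (R : realType) (X : Type) (P : problem R X) (s : X) : Prop :=
  feasible P s /\
  forall s', feasible P s' ->
    match goal P with
    | Minimize => objective P s <= objective P s'
    | Maximize => objective P s' <= objective P s
    end.

(* The optimum is a finite real and is attained. *)
Definition optimal_value (R : realType) (X : Type) (P : problem R X) (v : R) :
    Prop :=
  exists s, optimal P s /\ objective P s = v.

(* [P] decouples into the independent problems [Q j]: a point of [P] is the
   same thing as an arbitrary family of points of the [Q j] (its slices),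
   feasibility is checked slice by slice and the objective is additive. *)
Definition splits_into (R : realType) (D : finType) (X Y : Type)
    (slice : D -> X -> Y) (P : problem R X) (Q : D -> problem R Y) : Prop :=
  [/\ forall j, goal (Q j) = goal P,
      forall u : D -> Y, exists! s, forall j, slice j s = u j,
      forall s, feasible P s <-> forall j, feasible (Q j) (slice j s)
    & forall s, objective P s = \sum_(j : D) objective (Q j) (slice j s)].

Inductive row_kind := RowLe | RowGe | RowEq.
Inductive var_kind := VarNonneg | VarNonpos | VarFree.

(* [V] indexes the variables and [W] the rows. *)
Record linprog (R : realType) (V W : finType) := LinProg {
  lp_goal : goal_kind;
  lp_cost : V -> R;
  lp_coef : W -> V -> R;
  lp_rhs : W -> R;
  lp_row : W -> row_kind;
  lp_var : V -> var_kind
}.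

Definition row_holds (R : realType) (s : row_kind) (lhs rhs : R) : Prop :=
  match s with
  | RowLe => lhs <= rhs
  | RowGe => rhs <= lhs
  | RowEq => lhs = rhs
  end.

Definition var_holds (R : realType) (s : var_kind) (v : R) : Prop :=
  match s with
  | VarNonneg => 0 <= v
  | VarNonpos => v <= 0
  | VarFree => True
  end.

Definition lp_problem (R : realType) (V W : finType) (L : linprog R V W) :
    problem R (V -> R) :=
  {| goal := lp_goal L;
     feasible := fun v =>
       (forall r, row_holds (lp_row L r) (\sum_q lp_coef L r q * v q)
                            (lp_rhs L r)) /\
       (forall q, var_holds (lp_var L q) (v q));
     objective := fun v => \sum_q lp_cost L q * v q |}.

Definition dual_goal (g : goal_kind) : goal_kind :=
  match g with Minimize => Maximize | Maximize => Minimize end.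

(* Sign of the dual variable of a primal row; [g] is the primal goal. *)
Definition dual_var (g : goal_kind) (s : row_kind) : var_kind :=
  match g, s with
  | _, RowEq => VarFree
  | Minimize, RowGe | Maximize, RowLe => VarNonneg
  | Minimize, RowLe | Maximize, RowGe => VarNonpos
  end.

(* Direction of the dual row of a primal variable; [g] is the primal goal. *)
Definition dual_row (g : goal_kind) (s : var_kind) : row_kind :=
  match g, s with
  | _, VarFree => RowEq
  | Minimize, VarNonneg | Maximize, VarNonpos => RowLe
  | Minimize, VarNonpos | Maximize, VarNonneg => RowGe
  end.

Definition lp_dual (R : realType) (V W : finType) (L : linprog R V W) :
    linprog R W V :=
  {| lp_goal := dual_goal (lp_goal L);
     lp_cost := lp_rhs L;
     lp_coef := fun q r => lp_coef L r q;
     lp_rhs := lp_cost L;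
     lp_row := fun q => dual_row (lp_goal L) (lp_var L q);
     lp_var := fun r => dual_var (lp_goal L) (lp_row L r) |}.

(* [P] is literally the linear program [L], once its unknowns are listed as a
   single vector by the bijection [vec]. *)
Definition problem_is_lp (R : realType) (X : Type) (V W : finType)
    (vec : X -> V -> R) (P : problem R X) (L : linprog R V W) : Prop :=
  [/\ bijective vec,
      goal P = lp_goal L,
      forall s, feasible P s <-> feasible (lp_problem L) (vec s)
    & forall s, objective P s = objective (lp_problem L) (vec s)].

Definition balanced_data (R : realType) (H : finType) (a b : H -> R) : Prop :=
  [/\ forall k, 0 <= a k, forall m, 0 <= b m & \sum_k a k = \sum_m b m].

Definition transportation (R : realType) (H : finType)
    (a b : H -> R) (c : H -> H -> R) : problem R (H -> H -> R) :=
  {| goal := Minimize;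
     feasible := fun t =>
       [/\ forall k, \sum_m t k m = a k,
           forall m, \sum_k t k m = b m
         & forall k m, 0 <= t k m];
     objective := fun t => \sum_k \sum_m c k m * t k m |}.

(* Row [inl k] is the supply constraint of origin [k], row [inr m] the demand
   constraint of destination [m]; the variables are the arcs [(k, m)]. *)
Definition transportation_lp (R : realType) (H : finType)
    (a b : H -> R) (c : H -> H -> R) :
    linprog R (H * H)%type (H + H)%type :=
  {| lp_goal := Minimize;
     lp_cost := fun q => c q.1 q.2;
     lp_coef := fun r q =>
       match r with
       | inl k => (q.1 == k)%:R
       | inr m => (q.2 == m)%:R
       end;
     lp_rhs := fun r => match r with inl k => a k | inr m => b m end;
     lp_row := fun _ => RowEq;
     lp_var := fun _ => VarNonneg |}.

Definition flow_vec (R : realType) (H : finType) (t : H -> H -> R) :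
    (H * H)%type -> R :=
  fun q => t q.1 q.2.

Definition potential_vec (R : realType) (H : finType)
    (ef : (H -> R) * (H -> R)) : (H + H)%type -> R :=
  fun r => match r with inl k => ef.1 k | inr m => ef.2 m end.

(* The (h - p + 1)-th smallest of the values C i j k m, m in H; [nth] counts
   from 0. *)
Definition bigM (R : realType) (O D H : finType) (p : nat)
    (C : O -> D -> H -> H -> R) (i : O) (j : D) (k : H) : R :=
  nth 0 (sort <=%R [seq C i j k m | m <- enum H]) (#|H| - p).

Record hub_point (R : realType) (O D H : finType) := HubPoint {
  hub_y : H -> R;
  hub_x : O -> H -> R;
  hub_z : O -> D -> H -> R;
  hub_pi : O -> R
}.

(* [dom] is the domain imposed on each of the variables y, x and z. *)
Definition hub_program (R : realType) (O D H : finType) (dom : R -> Prop)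
    (p : nat) (C : O -> D -> H -> H -> R) : problem R (hub_point R O D H) :=
  {| goal := Minimize;
     feasible := fun s =>
       let: HubPoint y x z pi := s in
       [/\ [/\ \sum_k y k <= p%:R,
               forall i k, x i k <= y k
             & forall i, \sum_k x i k = 1],
           [/\ forall m,
                 \sum_i \sum_j z i j m <= (#|O| * #|D|)%:R * y m
             & forall i j, \sum_m z i j m = 1],
           [/\ forall i k,
                 \sum_j ((\sum_m C i j k m * z i j m)
                         + bigM p C i j k * (x i k - 1)) <= pi i
             & forall i, 0 <= pi i]
         & [/\ forall k, dom (y k),
               forall i k, dom (x i k)
             & forall i j m, dom (z i j m)]];
     objective := fun s => \sum_i hub_pi s i |}.

Definition hub_formulation (R : realType) (O D H : finType) (p : nat)
    (C : O -> D -> H -> H -> R) : problem R (hub_point R O D H) :=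
  hub_program (fun v : R => v = 0 \/ v = 1) p C.

Definition hub_relaxation (R : realType) (O D H : finType) (p : nat)
    (C : O -> D -> H -> H -> R) : problem R (hub_point R O D H) :=
  hub_program (fun v : R => 0 <= v <= 1) p C.

(* [c], [xi] and [zi] are the data of a fixed origin i: c j k m = C i j k m,
   xi k = x i k and zi j m = z i j m. *)
Definition separation (R : realType) (D H : finType)
    (c : D -> H -> H -> R) (xi : H -> R) (zi : D -> H -> R) :
    problem R ((D -> H -> R) * (D -> H -> R)) :=
  {| goal := Maximize;
     feasible := fun ef => forall j k m, ef.1 j k + ef.2 j m <= c j k m;
     objective := fun ef =>
       \sum_j \sum_k ef.1 j k * xi k + \sum_j \sum_m ef.2 j m * zi j m |}.

(* [c], [xi] and [zij] are the data of a fixed origin-destination pair. *)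
Definition separation_sub (R : realType) (H : finType)
    (c : H -> H -> R) (xi zij : H -> R) : problem R ((H -> R) * (H -> R)) :=
  {| goal := Maximize;
     feasible := fun ef => forall k m, ef.1 k + ef.2 m <= c k m;
     objective := fun ef => \sum_k ef.1 k * xi k + \sum_m ef.2 m * zij m |}.

Definition separation_slice (R : realType) (D H : finType) (j : D)
    (ef : (D -> H -> R) * (D -> H -> R)) : (H -> R) * (H -> R) :=
  (ef.1 j, ef.2 j).

(* Main.v *)
Require Import Defs.
From HB Require Import structures.
From mathcomp Require Import all_boot all_order all_algebra.
From mathcomp Require Import boolp reals.
From mathcomp Require Import lra.
Set Implicit Arguments.
Unset Strict Implicit.
Unset Printing Implicit Defensive.
Import Order.TTheory GRing.Theory Num.Theory.
Local Open Scope ring_scope.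

(** The separation problem [separation] has no constraint linking two distinct
    destinations, and its objective is a sum over destinations, so it splits;
    for any problem that splits, the optimal points are exactly the families
    of optimal points of the parts, and optimal values add up
    ([splits_optimal], [splits_optimal_value]).  The duality claim is a matter
    of reading the transposed incidence matrix of the transportation problem:
    the column of the arc (k, m) has its two ones in the rows of k and m, hence
    the dual row of (k, m) is e k + f m <= c k m ([separation_sub_is_dual]).

    The claim with content is that every subproblem attains its optimum, though
    its feasible set is unbounded.  It is feasible since the costs are
    nonnegative (take e = f = 0), and it is bounded by weak duality against the
    product flow t k m = x k * z m, a transportation plan because supplies and
    demands both sum to 1 ([separation_sub_le]).  A feasible bounded linear
    program attains its maximum ([linear_max_attained]): from a feasible point,
    move along a direction that keeps the tight rows tight and improves the
    objective until another row becomes tight; this ends at a point where no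
    such direction exists.  Two such points with the same set of tight rows
    have the same value, as their difference is orthogonal to those rows.  So
    only finitely many values, one per set of rows, compete for the maximum. *)

(** * Attainment of the optimum of a bounded linear program *)

Definition dot (R : realType) (V : finType) (c x : V -> R) : R :=
  \sum_q c q * x q.

Lemma dot_shift (R : realType) (V : finType) (c x d : V -> R) (t : R) :
  dot c (fun q => x q + t * d q) = dot c x + t * dot c d.
Proof.
rewrite /dot mulr_sumr -big_split /=; apply: eq_bigr => q _.
by rewrite mulrDr mulrCA.
Qed.

Definition in_polyhedron (R : realType) (V W : finType) (A : W -> V -> R)
    (b : W -> R) (x : V -> R) : Prop :=
  forall r, dot (A r) x <= b r.

Definition tight (R : realType) (V W : finType) (A : W -> V -> R) (b : W -> R)
    (x : V -> R) : {set W} :=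
  [set r | dot (A r) x == b r].

(** Applied to d and to - d, the condition says that the objective is constant
    on the affine hull of the smallest face through x. *)
Definition face_optimal (R : realType) (V W : finType) (A : W -> V -> R)
    (b : W -> R) (c x : V -> R) : Prop :=
  in_polyhedron A b x /\
  forall d, (forall r, r \in tight A b x -> dot (A r) d = 0) -> dot c d <= 0.

(** The step length is the smallest ratio of slack to speed over the rows that
    the direction approaches; a row realizing it becomes tight.  Without such
    rows the whole ray would be feasible, and the objective unbounded. *)
Lemma improve_to_new_tight_row (R : realType) (V W : finType)
    (A : W -> V -> R) (b : W -> R) (c x d : V -> R) (B : R) :
  (forall y, in_polyhedron A b y -> dot c y <= B) ->
  in_polyhedron A b x ->
  (forall r, r \in tight A b x -> dot (A r) d = 0) ->
  0 < dot c d ->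
  exists y, [/\ in_polyhedron A b y, dot c x <= dot c y
              & tight A b x \proper tight A b y].
Proof.
move=> bounded x_in d_tight cd_gt0.
have [[r0 r0P]|no_block] := pselect (exists r, 0 < dot (A r) d); last first.
  pose t := (B - dot c x) / dot c d + 1.
  have t_ge0 : 0 <= t.
    by rewrite addr_ge0 // divr_ge0 ?(ltW cd_gt0) // subr_ge0 bounded.
  have /bounded : in_polyhedron A b (fun q => x q + t * d q).
    move=> r; rewrite dot_shift -[b r]addr0 lerD //.
    rewrite mulr_ge0_le0 // leNgt; apply/negP => rP.
    by apply: no_block; exists r.
  rewrite dot_shift mulrDl mul1r divfK ?lt0r_neq0 //.
  by move=> h; exfalso; lra.
pose ratio r := (b r - dot (A r) x) / dot (A r) d.
case: (@Order.TotalTheory.arg_minP _ _ _ r0 (fun r => 0 < dot (A r) d) ratio r0P).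
move=> r1 r1P r1_min.
have t_ge0 : 0 <= ratio r1 by rewrite divr_ge0 ?subr_ge0 ?(ltW r1P).
exists (fun q => x q + ratio r1 * d q); split.
- move=> r; rewrite dot_shift.
  have [rP|rN] := ltP 0 (dot (A r) d).
    by rewrite -lerBrDl -ler_pdivlMr //; apply: r1_min.
  by rewrite -[b r]addr0 lerD // mulr_ge0_le0.
- by rewrite dot_shift lerDl mulr_ge0 // ltW.
- apply/properP; split.
    apply/subsetP => r r_tight; rewrite inE dot_shift d_tight // mulr0 addr0.
    by rewrite inE in r_tight.
  exists r1; first by rewrite inE dot_shift divfK ?lt0r_neq0 // addrC subrK.
  by apply/negP => /d_tight r1_0; rewrite r1_0 ltxx in r1P.
Qed.

Lemma face_optimal_above (R : realType) (V W : finType)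
    (A : W -> V -> R) (b : W -> R) (c : V -> R) (B : R) (x : V -> R) :
  (forall y, in_polyhedron A b y -> dot c y <= B) ->
  in_polyhedron A b x ->
  exists y, face_optimal A b c y /\ dot c x <= dot c y.
Proof.
move=> bounded; have [n] := ubnP #|~: tight A b x|.
elim: n x => // n IHn x; rewrite ltnS => card_x x_in.
have [x_opt|x_nopt] := pselect (face_optimal A b c x); first by exists x.
have [d [d_tight cd_gt0]] : exists d,
    (forall r, r \in tight A b x -> dot (A r) d = 0) /\ 0 < dot c d.
  apply: contrapT => no_d; apply: x_nopt; split=> // d d_tight.
  by rewrite leNgt; apply/negP => cd_gt0; apply: no_d; exists d.
have [y [y_in xy tight_xy]] :=
  improve_to_new_tight_row bounded x_in d_tight cd_gt0.
have [|z [z_opt yz]] := IHn y _ y_in.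
  by apply: leq_trans card_x; apply: proper_card; rewrite properC.
by exists z; split=> //; apply: le_trans yz.
Qed.

(** The difference of the two points is orthogonal to their common tight
    rows. *)
Lemma face_optimal_le (R : realType) (V W : finType)
    (A : W -> V -> R) (b : W -> R) (c x y : V -> R) :
  face_optimal A b c x -> tight A b y = tight A b x -> dot c y <= dot c x.
Proof.
move=> [_ x_opt] tight_yx.
have dotB a : dot a (fun q => y q + -1 * x q) = dot a y - dot a x.
  by rewrite dot_shift mulN1r.
rewrite -subr_le0 -dotB; apply: x_opt => r r_x; rewrite dotB.
have r_y : r \in tight A b y by rewrite tight_yx.
move: r_x r_y; rewrite !inE => /eqP -> /eqP ->; exact: subrr.
Qed.

Lemma linear_max_attained (R : realType) (V W : finType)
    (A : W -> V -> R) (b : W -> R) (c : V -> R) (B : R) (x0 : V -> R) :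
  in_polyhedron A b x0 ->
  (forall x, in_polyhedron A b x -> dot c x <= B) ->
  exists x, in_polyhedron A b x /\
    forall y, in_polyhedron A b y -> dot c y <= dot c x.
Proof.
move=> x0_in bounded; have [x1 [x1_opt _]] := face_optimal_above bounded x0_in.
(* One face-optimal point per set of tight rows; [x1] is a default for the
   sets that are not realized. *)
have [pt ptP] : {pt : {set W} -> V -> R & forall T, face_optimal A b c (pt T) /\
    forall y, face_optimal A b c y -> tight A b y = T -> dot c y <= dot c (pt T)}.
  apply: (@choice _ _ (fun T x => face_optimal A b c x /\
    forall y, face_optimal A b c y -> tight A b y = T -> dot c y <= dot c x)).
  move=> T.
  have [[x [x_opt xT]]|noT] :=
    pselect (exists x, face_optimal A b c x /\ tight A b x = T).
    exists x; split=> // y _ yT.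
    by apply: face_optimal_le x_opt _; rewrite yT xT.
  by exists x1; split=> // y y_opt yT; case: noT; exists y.
case: (@Order.TotalTheory.arg_maxP _ _ _ set0 xpredT (fun T => dot c (pt T)) isT).
move=> T _ T_max; exists (pt T); split; first by case: (ptP T) => [[]].
move=> y /(face_optimal_above bounded)[z [z_opt yz]].
apply: le_trans yz _; apply: le_trans (T_max (tight A b z) isT).
by case: (ptP (tight A b z)) => _; apply.
Qed.

(** * Problems that split *)

(** For the direct implication, a feasible point of one part is glued to the
    other slices of the given optimal point, so that the two objectives differ
    in that part only. *)
Lemma splits_optimal (R : realType) (D : finType) (X Y : Type)
    (slice : D -> X -> Y) (P : problem R X) (Q : D -> problem R Y) (s : X) :
  splits_into slice P Q ->
  optimal P s <-> forall j, optimal (Q j) (slice j s).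
Proof.
move=> [goalE glue feasE objE]; split=> [[s_feas s_best] j|s_opt].
  split=> [|y y_feas]; first by move/feasE: s_feas.
  pose u j' := if j' == j then y else slice j' s.
  have [s' [s'P _]] := glue u.
  have s'_feas : feasible P s'.
    apply/feasE => j'; rewrite s'P /u; case: eqP => [->//|_].
    by move/feasE: s_feas.
  have objD t : objective P t = objective (Q j) (slice j t) +
      \sum_(j' | j' != j) objective (Q j') (slice j' t).
    by rewrite objE (bigD1 j).
  have := s_best _ s'_feas; rewrite goalE !objD s'P /u eqxx.
  have -> : \sum_(j' | j' != j) objective (Q j') (slice j' s') =
            \sum_(j' | j' != j) objective (Q j') (slice j' s).
    by apply: eq_bigr => j' /negbTE j'j; rewrite s'P /u j'j.
  by case: (goal P); rewrite lerD2r.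
split=> [|s' /feasE s'_feas]; first by apply/feasE => j; case: (s_opt j).
rewrite !objE; case goalP: (goal P); apply: ler_sum => j _.
  by case: (s_opt j) => _ /(_ _ (s'_feas j)); rewrite goalE goalP.
by case: (s_opt j) => _ /(_ _ (s'_feas j)); rewrite goalE goalP.
Qed.

Lemma splits_optimal_value (R : realType) (D : finType) (X Y : Type)
    (slice : D -> X -> Y) (P : problem R X) (Q : D -> problem R Y)
    (v : D -> R) :
  splits_into slice P Q -> (forall j, optimal_value (Q j) (v j)) ->
  optimal_value P (\sum_j v j).
Proof.
move=> split_P /choice[u uP]; have [_ glue _ objE] := split_P.
have [s [sP _]] := glue u; exists s; split.
  by apply/(splits_optimal _ split_P) => j; rewrite sP; case: (uP j).
by rewrite objE; apply: eq_bigr => j _; rewrite sP; case: (uP j).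
Qed.

Lemma separation_splits (R : realType) (D H : finType)
    (c : D -> H -> H -> R) (xi : H -> R) (zi : D -> H -> R) :
  splits_into (@separation_slice R D H) (separation c xi zi)
    (fun j => separation_sub (c j) xi (zi j)).
Proof.
split=> [//|u|s|s]; last by rewrite /= -big_split.
- exists (fun j => (u j).1, fun j => (u j).2); split.
    by move=> j; rewrite /separation_slice /=; case: (u j).
  move=> [e f] efP; congr (_, _); apply: funext => j.
    by rewrite -(efP j).
  by rewrite -(efP j).
- by split=> sP j; apply: sP.
Qed.

(** * Linear programming duality for the transportation problem *)

Lemma sum_delta (R : realType) (H : finType) (k : H) (F : H -> R) :
  \sum_k' (k' == k)%:R * F k' = F k.
Proof.
rewrite (bigD1 k) //= eqxx mul1r big1 ?addr0 // => k' /negbTE ->.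
by rewrite mul0r.
Qed.

Lemma transportation_is_lp (R : realType) (H : finType) (a b : H -> R)
    (c : H -> H -> R) :
  problem_is_lp (@flow_vec R H) (transportation a b c)
    (transportation_lp a b c).
Proof.
have supplyE (t : H -> H -> R) k :
    \sum_q (q.1 == k)%:R * flow_vec t q = \sum_m t k m.
  rewrite -(pair_bigA _ (fun k' m => (k' == k)%:R * t k' m)) /=.
  under eq_bigr do rewrite -mulr_sumr.
  exact: (sum_delta k (fun k' => \sum_m t k' m)).
have demandE (t : H -> H -> R) m :
    \sum_q (q.2 == m)%:R * flow_vec t q = \sum_k t k m.
  rewrite -(pair_bigA _ (fun k m' => (m' == m)%:R * t k m')) /=.
  by apply: eq_bigr => k _; apply: (sum_delta m (fun m' => t k m')).
split=> // [|t|t].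
- exists (fun v k m => v (k, m)) => // v.
  by apply: funext => -[].
- split=> /= [[supply demand t_ge0]|[rows t_ge0]].
    split=> [[k|m]|[k m]]; last exact: t_ge0.
      by rewrite supplyE.
    by rewrite demandE.
  split=> [k|m|k m]; last exact: (t_ge0 (k, m)).
    by rewrite -supplyE; apply: (rows (inl k)).
  by rewrite -demandE; apply: (rows (inr m)).
- by rewrite /= (pair_bigA _ (fun k m => c k m * t k m)).
Qed.

Lemma dual_rowE (R : realType) (H : finType) (a b : H -> R) (c : H -> H -> R)
    (e f : H -> R) (k m : H) :
  \sum_r lp_coef (lp_dual (transportation_lp a b c)) (k, m) r
           * potential_vec (e, f) r = e k + f m.
Proof.
rewrite big_sumType /=; congr (_ + _).
  by under eq_bigr do rewrite eq_sym; exact: sum_delta.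
by under eq_bigr do rewrite eq_sym; exact: sum_delta.
Qed.

Lemma separation_sub_is_dual (R : realType) (H : finType) (a b : H -> R)
    (c : H -> H -> R) :
  problem_is_lp (@potential_vec R H) (separation_sub c a b)
    (lp_dual (transportation_lp a b c)).
Proof.
split=> // [|[e f]|[e f]].
- exists (fun v => (fun k => v (inl k), fun m => v (inr m))).
    by move=> [e f].
  by move=> v; apply: funext => -[].
- split=> [ef_le|[rows _] k m].
    by split=> // -[k m]; rewrite /row_holds /= (dual_rowE a b c); apply: ef_le.
  by have := rows (k, m); rewrite /row_holds /= (dual_rowE a b c).
- rewrite /= big_sumType /=; congr (_ + _); apply: eq_bigr => ? _; exact: mulrC.
Qed.

(** * Optimal values of the separation subproblems *)

(** Weak duality against the product flow a k * b m. *)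
Lemma separation_sub_le (R : realType) (H : finType) (a b : H -> R)
    (c : H -> H -> R) (e f : H -> R) :
  (forall k, 0 <= a k) -> (forall m, 0 <= b m) ->
  \sum_k a k = 1 -> \sum_m b m = 1 ->
  (forall k m, e k + f m <= c k m) ->
  \sum_k e k * a k + \sum_m f m * b m <= \sum_k \sum_m c k m * (a k * b m).
Proof.
move=> a_ge0 b_ge0 a_sum b_sum ef_le.
have -> : \sum_k e k * a k = \sum_k \sum_m e k * (a k * b m).
  by apply: eq_bigr => k _; rewrite -!mulr_sumr b_sum mulr1.
have -> : \sum_m f m * b m = \sum_k \sum_m f m * (a k * b m).
  rewrite exchange_big /=; apply: eq_bigr => m _.
  by rewrite -mulr_sumr -mulr_suml a_sum mul1r.
rewrite -big_split; apply: ler_sum => k _ /=.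
rewrite -big_split; apply: ler_sum => m _ /=.
by rewrite -mulrDl ler_wpM2r // mulr_ge0.
Qed.

Lemma separation_sub_attained (R : realType) (H : finType) (a b : H -> R)
    (c : H -> H -> R) :
  (forall k, 0 <= a k) -> (forall m, 0 <= b m) ->
  \sum_k a k = 1 -> \sum_m b m = 1 -> (forall k m, 0 <= c k m) ->
  exists v, optimal_value (separation_sub c a b) v.
Proof.
move=> a_ge0 b_ge0 a_sum b_sum c_ge0.
have [[unvec vecK unvecK] _ feasE objE] := separation_sub_is_dual a b c.
set L := lp_dual _ in feasE objE.
have feasible_polyhedron ef : feasible (separation_sub c a b) ef <->
    in_polyhedron (lp_coef L) (lp_rhs L) (potential_vec ef).
  rewrite feasE; split=> [[rows _] //|rows]; split=> //.
have [||x [x_in x_max]] := @linear_max_attained _ _ _ (lp_coef L) (lp_rhs L)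
    (lp_cost L) (\sum_k \sum_m c k m * (a k * b m))
    (potential_vec (fun=> 0, fun=> 0)).
- by apply/feasible_polyhedron => k m /=; rewrite addr0.
- move=> x; rewrite -[x]unvecK => /feasible_polyhedron ef_le.
  by rewrite -[dot _ _]/(objective (lp_problem L) _) -objE; apply: separation_sub_le.
exists (objective (separation_sub c a b) (unvec x)), (unvec x); split=> //.
split=> [|ef /feasible_polyhedron ef_in].
  by apply/feasible_polyhedron; rewrite unvecK.
suff : objective (separation_sub c a b) ef <=
       objective (separation_sub c a b) (unvec x) by [].
by rewrite !objE unvecK; apply: x_max.
Qed.

Theorem mainTheorem3 (R : realType) (O D H : finType) (p : nat)
    (C : O -> D -> H -> H -> R)
    (O_gt0 : (0 < #|O|)%N) (D_gt0 : (0 < #|D|)%N) (H_gt0 : (0 < #|H|)%N)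
    (p_bounds : (2 <= p <= #|H| - 1)%N)
    (C_ge0 : forall i j k m, 0 <= C i j k m)
    (ybar : H -> R) (xbar : O -> H -> R) (zbar : O -> D -> H -> R)
    (pibar : O -> R)
    (hfeas : feasible (hub_relaxation p C) (HubPoint ybar xbar zbar pibar))
    (i : O) :
  let S := separation (C i) (xbar i) (zbar i) in
  let Ssub := fun j => separation_sub (C i j) (xbar i) (zbar i j) in
  [/\ splits_into (@separation_slice R D H) S Ssub,
      exists v : D -> R,
        (forall j, optimal_value (Ssub j) (v j)) /\
        optimal_value S (\sum_j v j),
      forall e f : D -> H -> R,
        optimal S (e, f) <-> forall j, optimal (Ssub j) (e j, f j)
    & forall j,
        [/\ balanced_data (xbar i) (zbar i j),
            problem_is_lp (@flow_vec R H)
              (transportation (xbar i) (zbar i j) (C i j))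
              (transportation_lp (xbar i) (zbar i j) (C i j))
          & problem_is_lp (@potential_vec R H)
              (Ssub j)
              (lp_dual (transportation_lp (xbar i) (zbar i j) (C i j)))]].
Proof.
move=> S Ssub.
have [x_sum z_sum x_ge0 z_ge0] : [/\ \sum_k xbar i k = 1,
    forall j, \sum_m zbar i j m = 1, forall k, 0 <= xbar i k
    & forall j m, 0 <= zbar i j m].
  case: hfeas => [[_ _ x_sum] [_ z_sum] _ [_ x_dom z_dom]].
  by split=> // [k|j m]; [case/andP: (x_dom i k)|case/andP: (z_dom i j m)].
have S_splits : splits_into (@separation_slice R D H) S Ssub.
  exact: separation_splits.
split=> // [|e f|j].
- have /choice[v vP] j : exists v, optimal_value (Ssub j) v.
    exact: separation_sub_attained.
  by exists v; split=> //; apply: splits_optimal_value S_splits vP.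
- exact: (splits_optimal (e, f) S_splits).
- split; last exact: separation_sub_is_dual.
    by split=> //; rewrite x_sum z_sum.
  exact: transportation_is_lp.
Qed.
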